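(* Let $(R,B)$ be any SP-game such that its illegal complex $\Gamma_{R,B}$ is a non-empty graph. Then there exists an invariant independence game $(R',B')$ such that $\Delta_{R,B}=\Delta_{R',B'}$. If moreover $\Gamma_{R,B}$ has no isolated vertices, then also $\Gamma_{R,B}=\Gamma_{R',B'}$.
   Context: A board is a finite graph. A ruleset $R$ specifies which pieces each of the two players, Left and Right, may place (each piece occupies a non-empty collection of vertices of the board) and which placements are legal; $(R,B)$ denotes the game with ruleset $R$ played on board $B$. A position is a configuration of pieces on the board. A basic position is the board with exactly one piece placed (a Left or Right basic position according to who owns the piece). A position is legal if it can be reached from the empty board by a sequence of legal moves, and illegal otherwise. A strong placement game (SP-game) is a combinatorial game (two players, perfect information, no chance, no simultaneous moves) such that: (i) the board is empty at the beginning; (ii) players place pieces on empty spaces of the board according to the rules; (iii) pieces are not moved or removed once placed; (iv) if a position can be reached through a sequence of legal moves, then any sequence of moves leading to this position consists of legal moves. Hence a position is identified with the set of basic positions it is made of, and every subset of a legal position is legal. An SP-ruleset is the ruleset of SP-games. The legal complex $\Delta_{R,B}$ is the simplicial complex on the set of basic positions whose faces are the legal positions. The illegal complex $\Gamma_{R,B}$ is the simplicial complex on the set of basic positions whose facets are the minimal illegal positions (illegal positions all of whose proper subsets are legal); it is empty if there are no illegal positions. An illegal complex is a graph if its facets have one or two elements; an isolated vertex is a vertex $v$ such that $\{v\}$ is a facet. Equality of game complexes means that they have the same faces after identification of vertices (the $0$-dimensional faces of the legal complexes; all basic positions in the statement about illegal complexes) which sends Left basic positions to Left basic positions and Right to Right.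 A board isomorphism between two boards (possibly already containing pieces) is a graph isomorphism such that a vertex contains a Left (respectively Right) piece if and only if its image does. An SP-ruleset is invariant if: every basic position is legal; and it does not depend on the board, i.e. for any board isomorphism between boards $B_1$ and $B_2$, a move in $B_1$ is legal if and only if its isomorphic image in $B_2$ is legal. An SP-ruleset $R$ is an independence ruleset if for every board $B$ the illegal complex $\Gamma_{R,B}$ is a graph without isolated vertices, i.e. a pure one-dimensional simplicial complex (boards with no illegal positions, i.e. with empty illegal complex, are allowed). An SP-game $(R,B)$ is an independence game if $R$ is an independence ruleset; it is an invariant independence game if $R$ is in addition invariant. *)

(* Defs.v *)
From mathcomp Require Import all_boot.

Set Implicit Arguments.
Unset Strict Implicit.
Unset Printing Implicit Defensive.

Inductive player := Left | Right.

Record board := Board {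
  vertex :> finType;
  adj : rel vertex;
  adj_sym : symmetric adj;
  adj_irr : irreflexive adj
}.

(* A placement [(p, S)] is the piece [p] lying on the set of vertices [S].
   [fits p S] says that the ruleset lets [p] occupy [S] on the board;
   [move_ok P x] is the rule deciding whether [x] may be added to the
   configuration [P].  A piece may have several shapes, and distinct pieces
   (say, colours) may occupy the same vertices. *)
Record ruleset := Ruleset {
  piece : finType;
  owner : piece -> player;
  fits : forall B : board, piece -> {set B} -> bool;
  move_ok : forall B : board,
    {set piece * {set B}} -> piece * {set B} -> bool
}.

Definition placement (R : ruleset) (B : board) : finType :=
  (piece R * {set B})%type.

Definition placement_owner (R : ruleset) (B : board) (x : placement R B) :
  player := owner x.1.

Definition basic (R : ruleset) (B : board) (x : placement R B) : bool :=
  (x.2 != set0) && fits x.1 x.2.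

(* Positions may be illegal; in particular their pieces may overlap. *)
Definition is_position (R : ruleset) (B : board) (P : {set placement R B}) :
  Prop := forall x, x \in P -> basic x.

Definition legal_move (R : ruleset) (B : board) (P : {set placement R B})
  (x : placement R B) : bool := basic x && move_ok P x.

(* Legality of a sequence of moves played from [P].  The two players need not
   alternate. *)
Fixpoint legal_run (R : ruleset) (B : board) (P : {set placement R B})
  (s : seq (placement R B)) : bool :=
  if s is x :: s' then legal_move P x && legal_run (x |: P) s' else true.

Definition legal (R : ruleset) (B : board) (P : {set placement R B}) : Prop :=
  exists2 s : seq (placement R B), legal_run set0 s & [set x in s] = P.

Definition illegal (R : ruleset) (B : board) (P : {set placement R B}) :
  Prop := is_position P /\ ~ legal P.

Definition minimal_illegal (R : ruleset) (B : board)
  (P : {set placement R B}) : Prop :=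
  illegal P /\ forall Q : {set placement R B}, Q \proper P -> legal Q.

(* That the board is initially empty and that pieces are never moved or
   removed is built into [legal_run]. *)
Definition sp_game (R : ruleset) (B : board) : Prop :=
  (forall (P : {set placement R B}) (x y : placement R B),
      legal P -> legal_move P x -> y \in P -> [disjoint x.2 & y.2])
  /\
  (forall s t : seq (placement R B),
      legal_run set0 s -> uniq t -> [set x in t] = [set x in s] ->
      legal_run set0 t).

Definition sp_ruleset (R : ruleset) : Prop := forall B : board, sp_game R B.

(* A simplicial complex is represented by its predicate of faces.  The empty
   complex has no face at all, not even the empty set. *)
Section Complex.
Variable T : finType.
Implicit Types (C : {set T} -> Prop) (F G : {set T}).

Definition facet C F : Prop :=
  C F /\ forall G, C G -> F \subset G -> G = F.

Definition nonempty_complex C : Prop := exists F, C F.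

Definition graph_complex C : Prop :=
  forall F, facet C F -> #|F| = 1 \/ #|F| = 2.

Definition isolated_vertex C (x : T) : Prop := facet C [set x].

Definition no_isolated_vertices C : Prop := forall x, ~ isolated_vertex C x.

End Complex.

(* [V] and [V'] are the vertex sets being identified by [f]. *)
Definition same_complex (T T' : finType) (own : T -> player)
  (own' : T' -> player) (V : T -> Prop) (V' : T' -> Prop)
  (C : {set T} -> Prop) (C' : {set T'} -> Prop) : Prop :=
  exists f : T -> T',
    [/\ forall x, V x -> V' (f x) /\ own' (f x) = own x,
        forall x y, V x -> V y -> f x = f y -> x = y,
        forall y, V' y -> exists2 x, V x & f x = y
      & forall F', C' F' <-> exists2 F, C F & F' = f @: F].

Definition legal_complex (R : ruleset) (B : board)
  (F : {set placement R B}) : Prop := legal F.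

Definition illegal_complex (R : ruleset) (B : board)
  (F : {set placement R B}) : Prop :=
  exists2 M : {set placement R B}, minimal_illegal M & F \subset M.

Definition same_legal_complex (R : ruleset) (B : board)
  (R' : ruleset) (B' : board) : Prop :=
  same_complex (@placement_owner R B) (@placement_owner R' B')
    (fun x => legal_complex [set x]) (fun x => legal_complex [set x])
    (@legal_complex R B) (@legal_complex R' B').

Definition same_illegal_complex (R : ruleset) (B : board)
  (R' : ruleset) (B' : board) : Prop :=
  same_complex (@placement_owner R B) (@placement_owner R' B')
    (@basic R B) (@basic R' B')
    (@illegal_complex R B) (@illegal_complex R' B').

Definition occupied (R : ruleset) (B : board) (P : {set placement R B})
  (a : player) (v : B) : Prop :=
  exists2 x : placement R B, x \in P & placement_owner x = a /\ v \in x.2.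

(* Only the owner of the piece on each vertex is preserved, not the pieces
   themselves. *)
Definition board_iso (R : ruleset) (B1 B2 : board)
  (P1 : {set placement R B1}) (P2 : {set placement R B2})
  (f : B1 -> B2) : Prop :=
  [/\ bijective f,
      forall u v : B1, adj (f u) (f v) = adj u v
    & forall (a : player) (v : B1), occupied P1 a v <-> occupied P2 a (f v)].

Definition placement_image (R : ruleset) (B1 B2 : board) (f : B1 -> B2)
  (x : placement R B1) : placement R B2 := (x.1, f @: x.2).

Definition invariant_ruleset (R : ruleset) : Prop :=
  [/\ sp_ruleset R,
      forall (B : board) (x : placement R B), basic x -> legal [set x]
    & forall (B1 B2 : board) (P1 : {set placement R B1})
        (P2 : {set placement R B2}) (f : B1 -> B2),
        is_position P1 -> is_position P2 -> board_iso P1 P2 f ->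
        forall x : placement R B1,
          legal_move P1 x = legal_move P2 (placement_image f x)].

Definition independence_ruleset (R : ruleset) : Prop :=
  sp_ruleset R /\
  forall B : board, graph_complex (@illegal_complex R B) /\
                    no_isolated_vertices (@illegal_complex R B).

(* Being an (invariant) independence game is a property of the ruleset
   alone. *)
Definition invariant_independence_game (R : ruleset) (B : board) : Prop :=
  independence_ruleset R /\ invariant_ruleset R.

(* Main.v *)
(** As the illegal complex is a graph, a position is legal as soon as all its
    pairs [{x, y}] (including [x = y]) are legal.  Conversely, for any ruleset
    whose only rule is that pieces may not overlap, the minimal illegal
    positions are pairs of overlapping basic positions, so it is an
    independence ruleset.  It thus suffices to turn every legal basic position
    [x] into a piece occupying a region such that two regions meet exactly when
    their pieces conflict.  For invariance, the region of [x] is the set of all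
    vertices whose degree codes a conflicting pair [{x, y}] or [{x, x}]; on a
    half graph every code is the degree of some vertex. *)

Require Import Defs.
From mathcomp Require Import all_boot.

Set Implicit Arguments.
Unset Strict Implicit.
Unset Printing Implicit Defensive.

(** * Legal and minimal illegal positions of an SP-game *)

Section Legality.
Variables (R : ruleset) (B : board).
Implicit Types (P Q M F : {set placement R B}) (x y : placement R B).
Implicit Types s t : seq (placement R B).

Lemma legal_run_cat P s t : legal_run P (s ++ t) -> legal_run P s.
Proof. by elim: s P => //= x s IHs P /andP[-> /IHs]. Qed.

Lemma legal_run_basic P s x : legal_run P s -> x \in s -> basic x.
Proof.
elim: s P => //= y s IHs P /andP[/andP[hby _] /IHs hs].
by rewrite inE => /orP[/eqP-> | /hs].
Qed.

Lemma legal_position P : legal P -> is_position P.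
Proof. by case=> s hs <- x; rewrite inE; apply: legal_run_basic hs. Qed.

Lemma legal0 : legal (set0 : {set placement R B}).
Proof. by exists [::] => //; apply/setP=> x; rewrite !inE. Qed.

Definition pairwise_determined : Prop :=
  forall P, (forall x y, x \in P -> y \in P -> legal [set x; y]) -> legal P.

Hypothesis hsp : sp_game R B.

(** Move order is irrelevant in an SP-game, so a canonical enumeration decides legality. This
    justifies the later arguments by contradiction. *)
Lemma legalP P : reflect (legal P) (legal_run set0 (enum P)).
Proof.
have PE : [set x in enum P] = P by apply/setP=> x; rewrite inE mem_enum.
apply: (iffP idP) => [hP | [s hs sP]]; first by exists (enum P).
by apply: hsp.2 hs (enum_uniq _) _; rewrite PE.
Qed.

(** Play the elements of [Q] first: a prefix of a legal run is legal. *)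
Lemma legal_sub P Q : legal P -> Q \subset P -> legal Q.
Proof.
move=> [s hs sP] QP.
have : legal_run set0 (enum Q ++ enum (P :\: Q)).
  apply: hsp.2 hs _ _.
    rewrite cat_uniq !enum_uniq andbT /=; apply/hasPn=> x.
    by rewrite !mem_enum inE => /andP[].
  rewrite sP; apply/setP=> x; rewrite inE mem_cat !mem_enum inE.
  by case: (boolP (x \in Q)) => //= xQ; rewrite (subsetP QP).
by move/legal_run_cat/legalP.
Qed.

Lemma minimal_illegal_facet M :
  minimal_illegal M -> facet (@illegal_complex R B) M.
Proof.
move=> hM; split; first by exists M.
move=> G [N [[_ nN] hN] GN] MG; apply/eqP; rewrite eqEsubset MG andbT.
apply: contraT => nGM; case: (hM.1.2); apply: hN.
by apply: proper_sub_trans GN; rewrite properE MG.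
Qed.

Lemma facet_minimal_illegal F :
  facet (@illegal_complex R B) F -> minimal_illegal F.
Proof.
by case=> [[M hM FM] hF]; rewrite -(hF M) //; exists M.
Qed.

Lemma exists_minimal_illegal P :
  illegal P -> exists2 M, minimal_illegal M & M \subset P.
Proof.
case=> pP /legalP nP.
have [M /minsetP[nM hM] MP] :=
  @minset_exists _ (fun Q => ~~ legal_run set0 (enum Q)) P nP.
exists M => //; split.
  by split; [move=> x /(subsetP MP)/pP | apply/legalP].
move=> Q QM; apply/legalP; apply: contraT => nQ.
by move: (QM); rewrite (hM Q nQ (proper_sub QM)) properxx.
Qed.

(** Used contrapositively: without isolated vertices, every basic position is legal. *)
Lemma illegal_single_isolated x :
  basic x -> ~ legal [set x] -> isolated_vertex (@illegal_complex R B) x.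
Proof.
move=> bx nx; apply: minimal_illegal_facet; split.
  by split=> // y /set1P->.
by move=> Q; rewrite properE subset1 => /andP[/orP[/eqP-> /negP[] // | /eqP->] _];
  apply: legal0.
Qed.

(** An illegal [P] would contain a minimal illegal position. This is a facet, so it has one or two
    elements and is one of the pairs assumed legal. *)
Lemma graph_pairwise_determined :
  graph_complex (@illegal_complex R B) -> pairwise_determined.
Proof.
move=> hg P hP; apply/legalP; apply: contraT => /legalP nP.
have pP : is_position P.
  by move=> x xP; apply: (legal_position (hP x x xP xP)); rewrite !inE eqxx.
have [M hM MP] := exists_minimal_illegal (conj pP nP).
case: (hM.1.2); case: (hg M (minimal_illegal_facet hM)).
  move/eqP/cards1P=> [x Mx]; rewrite Mx -[[set x]]setUid; move: MP.
  by rewrite Mx sub1set => xP; apply: hP.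
move/eqP/cards2P=> [x [y [_ Mxy]]]; rewrite Mxy; apply: hP; apply: (subsetP MP).
  by rewrite Mxy set21.
by rewrite Mxy set22.
Qed.

(** Some pair inside [M] is illegal, since otherwise [M] would be legal; by minimality this pair is
    all of [M]. *)
Lemma minimal_illegal_pair M :
  pairwise_determined -> minimal_illegal M ->
  exists x y, [/\ x \in M, y \in M & M = [set x; y]].
Proof.
move=> hd hM.
have [/existsP[x /existsP[y /and3P[xM yM nxy]]] | hno] :=
  boolP [exists x, exists y,
   [&& x \in M, y \in M & ~~ legal_run set0 (enum [set x; y])]].
  exists x, y; split=> //; apply/eqP; rewrite eq_sym; apply: contraT => nM.
  case/legalP: nxy; apply: hM.2.
  by rewrite properEneq nM subUset !sub1set xM.
case: hM.1.2; apply: hd => x y xM yM; apply/legalP; apply: contraR hno => nxy.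
by apply/existsP; exists x; apply/existsP; exists y; rewrite xM yM.
Qed.

Hypothesis legal1 : forall x, basic x -> legal [set x].

(** When singletons are legal, each illegal pair is minimal: a proper subset misses one of the two
    elements and so lies in a singleton. *)
Lemma illegal_complexP F : pairwise_determined ->
  illegal_complex F <-> exists x y,
    [/\ basic x, basic y, ~ legal [set x; y] & F \subset [set x; y]].
Proof.
move=> hd; split=> [[M hM FM] | [x [y [bx hby nxy Fxy]]]].
  have [x [y [xM yM Mxy]]] := minimal_illegal_pair hd hM.
  by exists x, y; rewrite -Mxy; split=> //;
    [apply: hM.1.1 | apply: hM.1.1 | apply: hM.1.2].
exists [set x; y] => //; split.
  by split=> // z /set2P[] ->.
move=> Q /properP[Qxy [z zxy zQ]].
wlog zy : x y bx hby {nxy Fxy} Qxy zxy / z = y.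
  move=> IH; case/set2P: (zxy) => zE; last exact: (IH x y).
  by apply: (IH y x) => //; rewrite setUC.
apply: legal_sub (legal1 bx) _; apply/subsetP=> w wQ.
have := subsetP Qxy _ wQ; rewrite !inE => /orP[-> // | /eqP wy].
by rewrite zy -wy wQ in zQ.
Qed.

Lemma pairwise_determined_independence : pairwise_determined ->
  graph_complex (@illegal_complex R B) /\
  no_isolated_vertices (@illegal_complex R B).
Proof.
move=> hd; split=> [F /facet_minimal_illegal hF | x /facet_minimal_illegal hx].
  have [x [y [_ _ ->]]] := minimal_illegal_pair hd hF.
  by rewrite cards2; case: (x == y); [left | right].
by apply: hx.1.2; apply: legal1; apply: hx.1.1; rewrite inE.
Qed.

End Legality.

(** * Rulesets whose only rule is that pieces do not overlap *)

Section DisjointRuleset.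
Variables (T : finType) (own : T -> player).
Variable fit : forall B : board, T -> {set B} -> bool.

Definition disjoint_ruleset : ruleset :=
  @Ruleset T own fit (fun B P x => [forall y in P, [disjoint x.2 & y.2]]).

Local Notation R := disjoint_ruleset.

Section Board.
Variable B : board.
Implicit Types (P : {set placement R B}) (x y : placement R B).
Implicit Types s : seq (placement R B).

Lemma basic_ndisjoint x : basic x -> ~~ [disjoint x.2 & x.2].
Proof. by case/andP=> x0 _; rewrite -setI_eq0 setIid. Qed.

(** Apart from [uniq], the conditions depend only on the set of moves in [s], whence the order
    independence in [disjoint_sp]. The start [P] is arbitrary for the induction. *)
Lemma disjoint_runP P s :
  legal_run P s <->
  [/\ uniq s, {in s, forall x, basic x},
      {in s & P, forall x y, [disjoint x.2 & y.2]}
    & {in s &, forall x y, x != y -> [disjoint x.2 & y.2]}].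
Proof.
elim: s P => [|x s IHs] P /=; first by split.
split.
  case/andP=> /andP[bx /forall_inP dx] /IHs [us bs dP ds].
  have dsx y : y \in s -> [disjoint y.2 & x.2].
    by move=> ys; apply: dP; rewrite ?inE ?eqxx.
  split.
  (* A repeated placement would be disjoint from itself, although its region is non-empty. *)
  - rewrite us andbT; apply: contraT => /negPn xs.
    by move: (dsx x xs); rewrite (negPf (basic_ndisjoint bx)).
  - by move=> y; rewrite inE => /orP[/eqP-> | /bs].
  - move=> y z; rewrite inE => /orP[/eqP-> | ys] zP; first exact: dx.
    by apply: dP; rewrite // inE zP orbT.
  - move=> y z; rewrite !inE => /orP[/eqP-> | ys] /orP[/eqP-> | zs].
    + by rewrite eqxx.
    + by rewrite disjoint_sym => _; apply: dsx.
    + by move=> _; apply: dsx.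
    + exact: ds.
case=> /andP[xs us] bs dP ds; apply/andP; split.
  rewrite /legal_move bs ?mem_head //=; apply/forall_inP=> y.
  by apply: dP; rewrite mem_head.
apply/IHs; split=> //.
- by move=> y ys; apply: bs; rewrite inE ys orbT.
- move=> y z ys; rewrite !inE => /orP[/eqP-> | zP].
    apply: ds; rewrite ?inE ?eqxx ?ys ?orbT //.
    by apply: contraNneq xs => <-.
  by apply: dP; rewrite // inE ys orbT.
- by move=> y z ys zs; apply: ds; rewrite inE ?ys ?zs orbT.
Qed.

Lemma disjoint_legalP P :
  legal P <-> is_position P /\
              {in P &, forall x y, x != y -> [disjoint x.2 & y.2]}.
Proof.
split=> [[s /disjoint_runP[_ bs _ ds] <-] | [pP dP]].
  by split=> [x | x y]; rewrite !inE; [apply: bs | apply: ds].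
exists (enum P); last by apply/setP=> x; rewrite inE mem_enum.
apply/disjoint_runP; split; first exact: enum_uniq.
- by move=> x; rewrite mem_enum; apply: pP.
- by move=> x y _; rewrite inE.
- by move=> x y; rewrite !mem_enum; apply: dP.
Qed.

Lemma disjoint_legal1 x : basic x -> legal [set x].
Proof.
move=> bx; apply/disjoint_legalP; split=> [y /set1P-> // | y z].
by move=> /set1P-> /set1P->; rewrite eqxx.
Qed.

Lemma disjoint_legal2 x y :
  legal [set x; y] <->
  [/\ basic x, basic y & x != y -> [disjoint x.2 & y.2]].
Proof.
split=> [/disjoint_legalP[p d] | [bx hby d]].
  by split; [apply: p | apply: p | apply: d]; rewrite !inE eqxx ?orbT.
apply/disjoint_legalP; split=> [z /set2P[] -> // | z w].
by move=> /set2P[]-> /set2P[]->; rewrite ?eqxx // disjoint_sym eq_sym.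
Qed.

Lemma disjoint_pairwise_determined : pairwise_determined R B.
Proof.
move=> P hP; apply/disjoint_legalP; split=> [x xP | x y xP yP].
  by have /disjoint_legal2[] := hP x x xP xP.
by have /disjoint_legal2[] := hP x y xP yP.
Qed.

End Board.

Lemma disjoint_sp : sp_ruleset R.
Proof.
move=> B; split=> [P x y _ /andP[_ /forall_inP] | s t]; first exact.
move=> /disjoint_runP[us bs _ ds] ut ts.
have tsE : t =i s by move=> x; move/setP/(_ x): ts; rewrite !inE.
apply/disjoint_runP; split=> //.
- by move=> x; rewrite tsE; apply: bs.
- by move=> x y _; rewrite inE.
- by move=> x y; rewrite !tsE; apply: ds.
Qed.

Lemma disjoint_independence : independence_ruleset R.
Proof.
split=> [|B]; first exact: disjoint_sp.
by apply: pairwise_determined_independence (disjoint_sp B) _ _;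
  [apply: disjoint_legal1 | apply: disjoint_pairwise_determined].
Qed.

Hypothesis fit_iso : forall (B1 B2 : board) (f : B1 -> B2) p (S : {set B1}),
  bijective f -> (forall u v, adj (f u) (f v) = adj u v) ->
  fit p (f @: S) = fit p S.

(** Whether a fitting piece may be placed depends only on which vertices are occupied, and
    [board_iso] preserves that. *)
Lemma disjoint_invariant : invariant_ruleset R.
Proof.
split; [exact: disjoint_sp | exact: disjoint_legal1 |].
move=> B1 B2 P1 P2 f _ _ [bf af occ] x; congr andb.
  by rewrite /basic /= fit_iso // -!card_gt0 card_imset //; apply: bij_inj.
apply/forall_inP/forall_inP => d y yP; apply/pred0Pn => /= -[v /andP[]].
  move=> /imsetP[u ux ->] uy.
  (* The piece [z] need not correspond to [y]; it only has the same owner and covers [u]. *)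
  have [z zP [_ uz]] : occupied P1 (own y.1) u.
    by apply/occ; exists y.
  by move/disjointFr: (d z zP) => /(_ u ux); rewrite uz.
move=> vx vy.
have [z zP [_ vz]] : occupied P2 (own y.1) (f v).
  by apply/occ; exists y.
by move/disjointFr: (d z zP) => /(_ _ (imset_f f vx)); rewrite vz.
Qed.

End DisjointRuleset.

(** * Regions defined by vertex degrees *)

Definition degree (B : board) (v : B) : nat := #|[set w | adj v w]|.

Lemma degree_iso (B1 B2 : board) (f : B1 -> B2) (v : B1) :
  bijective f -> (forall u w, adj (f u) (f w) = adj u w) ->
  degree (f v) = degree v.
Proof.
move=> bf af; rewrite /degree -(card_imset _ (bij_inj bf)); apply: eq_card => w.
have [g fK gK] := bf; rewrite inE -[w]gK af (mem_imset _ _ (bij_inj bf)).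
by rewrite inE.
Qed.

Section DegreeRuleset.
Variables (T : finType) (own : T -> player) (D : T -> pred nat).

(* On boards where no vertex has a degree in [D x], the piece [x] has an empty
   region and hence no basic position. *)
Definition degree_region (B : board) (x : T) : {set B} :=
  [set v | D x (degree v)].

(** With a single admissible region per piece, a basic position is determined by its piece. *)
Definition degree_ruleset : ruleset :=
  disjoint_ruleset own (fun B x S => S == degree_region B x).

(** Isomorphisms preserve degrees, so they carry the region of each piece onto its region on the
    other board. *)
Lemma degree_invariant_independence (B : board) :
  invariant_independence_game degree_ruleset B.
Proof.
split; first exact: disjoint_independence.
apply: disjoint_invariant => B1 B2 f p S bf af.
have -> : degree_region B2 p = f @: degree_region B1 p.
  have [g fK gK] := bf; apply/setP=> w; rewrite -[w]gK.
  by rewrite (mem_imset _ _ (bij_inj bf)) !inE degree_iso.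
by apply/eqP/eqP => [/(imset_inj (bij_inj bf)) | ->].
Qed.

End DegreeRuleset.

(** * Half graphs, which realise all degrees from [1] to [n] *)

Section HalfGraph.
Variable n : nat.

Definition half_adj (u v : 'I_n + 'I_n) : bool :=
  match u, v with
  | inl i, inr j => i <= j
  | inr j, inl i => i <= j
  | _, _ => false
  end.

Lemma half_adj_sym : symmetric half_adj.
Proof. by case=> i [j|j]. Qed.

Lemma half_adj_irr : irreflexive half_adj.
Proof. by case. Qed.

Definition half_graph : board := Board half_adj_sym half_adj_irr.

Lemma degree_half_graph (j : 'I_n) :
  degree (inr j : half_graph) = j.+1.
Proof.
have inj : injective (fun i : 'I_j.+1 => inl (widen_ord (ltn_ord j) i) : half_graph).
  by move=> i k [/val_inj].
rewrite /degree -[RHS]card_ord -(card_imset _ inj); apply: eq_card => -[i|i].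
  rewrite inE /=; apply/idP/imsetP => [ij | [k _ [->]]]; last exact: (leq_ord k).
  by exists (Ordinal (ij : i < j.+1)) => //; congr inl; apply: val_inj.
by rewrite inE /=; apply/esym/imsetP=> -[].
Qed.

End HalfGraph.

(** * Realisation of the complexes on a half graph *)

Theorem proposition3p2 (R : ruleset) (B : board)
  (hsp : sp_game R B)
  (hne : nonempty_complex (@illegal_complex R B))
  (hgraph : graph_complex (@illegal_complex R B)) :
  exists (R' : ruleset) (B' : board),
    [/\ invariant_independence_game R' B',
        same_legal_complex R B R' B'
      & no_isolated_vertices (@illegal_complex R B) ->
        same_illegal_complex R B R' B'].
Proof.
pose T := placement R B.
pose legalb (P : {set T}) := legal_run set0 (enum P).
have legalbP P : reflect (legal P) (legalb P) by apply: legalP.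
have hd := graph_pairwise_determined hsp hgraph.
(* A legal [x] conflicts with itself, so its region will be non-empty; an illegal one conflicts with
   nothing, so its region is empty and it disappears. *)
pose conflict (x y : T) :=
  [&& legalb [set x], legalb [set y] & (x == y) || ~~ legalb [set x; y]].
(* The code of an unordered pair is its rank, shifted by one because [inr j] has degree [j.+1]. *)
pose D (x : T) (d : nat) :=
  [exists y, conflict x y && (d == (enum_rank [set x; y]).+1)].
pose R' := degree_ruleset (@placement_owner R B) D.
(* One index for each subset of [T], so that every code is a degree. *)
pose B' := half_graph #|{set T}|.
pose f (x : T) : placement R' B' := (x, degree_region D B' x).
have f_inj : injective f by move=> x y [].
have f_meet x y : ~~ [disjoint (f x).2 & (f y).2] = conflict x y.
  apply/pred0Pn/idP => [[v /andP[]] | cxy]; last first.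
    exists (inr (enum_rank [set x; y])) => /=; rewrite !inE degree_half_graph.
    apply/andP; split; apply/existsP; first by exists y; rewrite cxy /=.
    exists x; rewrite setUC eqxx andbT /conflict.
    by case/and3P: cxy => -> -> /=; rewrite eq_sym setUC.
  (* Equal codes give [[set x; z] = [set y; w]], so [y] is [x] or [z]. Only the degree of [v]
     matters, so the vertices [inl i] cause no unwanted meetings. *)
  rewrite !inE => /existsP[z /andP[xz /eqP->]] /existsP[w /andP[yw]].
  rewrite eqSS => /eqP/val_inj/enum_rank_inj E.
  have: y \in [set x; z] by rewrite E set21.
  case/set2P=> [yx | -> //]; rewrite yx /conflict eqxx.
  by case/and3P: xz => ->.
(* A region is non-empty exactly when it meets itself, which is the diagonal case of [f_meet]. *)
have f_basic x : basic (f x) = legalb [set x].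
  transitivity (~~ [disjoint (f x).2 & (f x).2]).
    by rewrite /basic -setI_eq0 setIid /= eqxx andbT.
  by rewrite f_meet /conflict eqxx andbT andbb.
have basic_f y : @basic R' B' y -> y = f y.1.
  by case/andP=> _ /eqP; case: y => p S /= ->.
have f_legal2 x y : legal [set f x; f y] <-> legal [set x; y].
  apply: (iff_trans (disjoint_legal2 _ _)); rewrite !f_basic; split=> [[lx ly d] | lxy].
    have [<- | nxy] := eqVneq x y; first by rewrite setUid; apply/legalbP.
    apply/legalbP; move: d; rewrite (inj_eq f_inj) nxy => /(_ isT).
    by move/negPn; rewrite f_meet /conflict lx ly (negPf nxy) negbK.
  have lx : legalb [set x].
    by apply/legalbP/(legal_sub hsp lxy); rewrite sub1set set21.
  have ly : legalb [set y].
    by apply/legalbP/(legal_sub hsp lxy); rewrite sub1set set22.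
  split=> //; rewrite (inj_eq f_inj) => nxy; apply/negPn.
  by rewrite f_meet /conflict lx ly (negPf nxy) negbK /=; apply/legalbP.
have f_legal1 x : legal [set f x] <-> legal [set x].
  by rewrite -[[set f x]]setUid -[[set x]]setUid; apply: f_legal2.
have preimage (F' : {set placement R' B'}) : is_position F' ->
    F' = f @: (f @^-1: F').
  move=> pF; apply/setP=> y; apply/idP/imsetP => [yF | [x]].
    by exists y.1; rewrite ?inE -basic_f //; apply: pF.
  by rewrite inE => ? ->.
have hsp' : sp_game R' B' by apply: disjoint_sp.
exists R', B'; split; first exact: degree_invariant_independence.
- exists f; split.
  + by move=> x hx; split=> //; apply/f_legal1.
  + by move=> x y _ _ /f_inj.
  + move=> y hy; have yE : y = f y.1.
      by apply: basic_f; apply: legal_position hy _ _; rewrite set11.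
    by exists y.1 => //; apply/f_legal1; rewrite -yE.
  (* Both games are determined by their pairs, so [f_legal2] transfers all faces. *)
  + move=> F'; split=> [hF | [F hF ->]].
      have FE := preimage _ (legal_position hF).
      exists (f @^-1: F') => //; apply: hd => x y.
      rewrite !inE => xF yF; apply/f_legal2/(legal_sub hsp' hF).
      by rewrite subUset !sub1set xF.
    apply: disjoint_pairwise_determined => _ _ /imsetP[x xF ->] /imsetP[y yF ->].
    by apply/f_legal2/(legal_sub hsp hF); rewrite subUset !sub1set xF.
- move=> noiso.
  (* Now no basic position of [R] is lost, so [f] identifies all basic positions and not only the
     legal ones. *)
  have legal1 (x : placement R B) : basic x -> legal [set x].
    move=> bx; apply/legalbP; apply: contraT => /legalbP nx.
    by case: (noiso x); apply: illegal_single_isolated.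
  have f_basicE (x : placement R B) : basic (f x) = basic x.
    rewrite f_basic; apply/legalbP/idP => [hx | /legal1 //].
    by apply: legal_position hx _ _; rewrite set11.
  have hd' : pairwise_determined R' B' by apply: disjoint_pairwise_determined.
  have legal1' : forall x, @basic R' B' x -> legal [set x].
    exact: disjoint_legal1.
  exists f; split.
  + by move=> x; rewrite f_basicE.
  + by move=> x y _ _ /f_inj.
  + by move=> y hby; exists y.1; [rewrite -f_basicE -basic_f | rewrite -basic_f].
  + move=> F'; split=> [/(illegal_complexP hsp' legal1' _ hd') | [F]].
      move=> [x [y [bx hby nxy Fxy]]].
      have FE : F' = f @: (f @^-1: F').
        by apply: preimage => z /(subsetP Fxy)/set2P[] ->.
      exists (f @^-1: F') => //; apply/(illegal_complexP hsp legal1 _ hd).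
      exists x.1, y.1; rewrite -!f_basicE -!basic_f //; split=> //.
        by move/f_legal2; rewrite -!basic_f.
      apply/subsetP=> z; rewrite inE => /(subsetP Fxy).
      by rewrite !inE => /orP[] /eqP <-; rewrite eqxx ?orbT.
    move=> /(illegal_complexP hsp legal1 _ hd)[x [y [bx hby nxy Fxy]]] ->.
    apply/(illegal_complexP hsp' legal1' _ hd'); exists (f x), (f y).
    rewrite !f_basicE; split=> // [/f_legal2 // |].
    apply/subsetP=> _ /imsetP[z /(subsetP Fxy)/set2P[] -> ->];
      by rewrite !inE eqxx ?orbT.
Qed.
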